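(* Let $K$ be a field of characteristic different from $2$, and let $a(k),b(k)\in K[k]$ be nonzero polynomials such that \[ a(k) = - b(k+\alpha) \quad\text{and}\quad b(\beta+k) = \pm b(\beta-k) \] (for one of the two choices of sign, as identities in $K[k]$) for some $\alpha,\beta\in K$. Put \[ \gamma = -\beta + \frac{\alpha-1}{2}. \] Then for any non-negative integer $m$, we have \[ [(k+\gamma)^{2m}] \in \left\langle [(k+\gamma)^{2i}] \colon 0\le 2i < \deg a(k) \right\rangle \] and \[ [(k+\gamma)^{2m+1}] \in \left\langle [(k+\gamma)^{2i+1}] \colon 0\le 2i+1 < \deg a(k) \right\rangle . \]
   Context: For $a(k),b(k)\in K[k]$, the difference space corresponding to $a(k)$ and $b(k)$ is the $K$-linear subspace \[ S_{a,b} = \{a(k)x(k+1) - b(k-1)x(k) \colon x(k)\in K[k]\} \] of $K[k]$. For a polynomial $p(k)$, $[p(k)] = p(k)+S_{a,b}$ denotes its coset in the quotient vector space $K[k]/S_{a,b}$, and $\langle\cdots\rangle$ denotes the $K$-linear span in $K[k]/S_{a,b}$ (the index $i$ ranges over integers satisfying the displayed inequalities). *)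

(* Defs.v *)
(* Quotients are built from boolean relations: boolp supplies the classical
   reflection that turns S_{a,b} into a boolean predicate. *)
From HB Require Import structures.
From mathcomp Require Import all_boot all_order all_algebra.
From mathcomp Require Import boolp classical_sets.

Set Implicit Arguments.
Unset Strict Implicit.
Unset Printing Implicit Defensive.

Import GRing.Theory.
Local Open Scope ring_scope.
Local Open Scope quotient_scope.

(* ring_quotient provides V / S only as a Z-module; the scalar action
   a *: [v] = [a *: v] is added here. *)
Section QuotientModule.
Variables (R : nzRingType) (V : lmodType R) (S : submodClosed V).

(* submodClosed does not inherit from zmodClosed, whence this copy of S. *)
Definition submod_pred : {pred V} := fun v => v \in S.
HB.instance Definition _ := GRing.isZmodClosed.Build V submod_pred
  (GRing.subsemimod_closedB (GRing.subsemimodClosedP S)).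

Definition quotmod := Quotient.quot submod_pred.
HB.instance Definition _ := GRing.Zmodule.on quotmod.

Definition quotmod_pi (v : V) : quotmod := \pi_(Quotient.quot submod_pred) v.

Definition quotmod_scale (a : R) (q : quotmod) : quotmod :=
  quotmod_pi (a *: repr (q : Quotient.quot submod_pred)).

Lemma quotmod_piP (u v : V) : quotmod_pi u = quotmod_pi v <-> u - v \in S.
Proof.
have -> : (u - v \in S) = (u - v \in submod_pred) by [].
by rewrite Quotient.idealrBE; split=> /eqP.
Qed.

Lemma quotmod_reprK (q : quotmod) :
  quotmod_pi (repr (q : Quotient.quot submod_pred)) = q.
Proof. exact: (@reprK _ (Quotient.quot submod_pred)). Qed.

Lemma quotmod_piD (u v : V) : quotmod_pi (u + v) = quotmod_pi u + quotmod_pi v.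
Proof. exact: (raddfD (\pi_(Quotient.quot submod_pred))). Qed.

Lemma quotmod_piZ (a : R) (v : V) :
  quotmod_pi (a *: v) = quotmod_scale a (quotmod_pi v).
Proof.
apply/quotmod_piP; rewrite -scalerBr rpredZ //.
by apply/quotmod_piP; rewrite quotmod_reprK.
Qed.

Fact quotmod_scaleA a b q :
  quotmod_scale a (quotmod_scale b q) = quotmod_scale (a * b) q.
Proof. by rewrite -(quotmod_reprK q) -!quotmod_piZ scalerA. Qed.

Fact quotmod_scale1 : left_id 1 quotmod_scale.
Proof. by move=> q; rewrite -(quotmod_reprK q) -quotmod_piZ scale1r. Qed.

Fact quotmod_scaleDr : right_distributive quotmod_scale +%R.
Proof.
move=> a p q; rewrite -(quotmod_reprK p) -(quotmod_reprK q).
by rewrite -quotmod_piD -!quotmod_piZ -quotmod_piD scalerDr.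
Qed.

Fact quotmod_scaleDl q : {morph quotmod_scale^~ q : a b / a + b}.
Proof.
by move=> a b; rewrite -(quotmod_reprK q) -!quotmod_piZ -quotmod_piD scalerDl.
Qed.

HB.instance Definition _ := GRing.Zmodule_isLmodule.Build R quotmod
  quotmod_scaleA quotmod_scale1 quotmod_scaleDr quotmod_scaleDl.

Fact quotmod_pi_is_linear : linear quotmod_pi.
Proof. by move=> a u v; rewrite quotmod_piD quotmod_piZ. Qed.

HB.instance Definition _ := GRing.isLinear.Build R V quotmod *:%R quotmod_pi
  quotmod_pi_is_linear.

End QuotientModule.

Definition lin_span (R : nzRingType) (V : lmodType R) (G : set V) : set V :=
  [set v | exists (n : nat) (c : 'I_n -> R) (g : 'I_n -> V),
     (forall i, G (g i)) /\ v = \sum_(i < n) c i *: g i].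

Section DifferenceSpace.
Variable K : fieldType.
Implicit Types a b p x : {poly K}.

(* The variable k of K[k] is 'X, and the shift p(k + c) is p \Po ('X + c%:P). *)
Definition diff_op a b x : {poly K} :=
  a * (x \Po ('X + 1)) - (b \Po ('X - 1)) * x.

Definition diff_space a b : {pred {poly K}} :=
  [pred p | `[< exists x, p = diff_op a b x >]].

Fact diff_space_submod a b : submod_closed (diff_space a b).
Proof.
split=> [|c p q].
  by apply/asboolP; exists 0; rewrite /diff_op comp_poly0 !mulr0 subr0.
move=> /asboolP[x ->] /asboolP[y ->]; apply/asboolP; exists (c *: x + y).
rewrite /diff_op linearP /= !mulrDr -!scalerAr scalerBr opprD.
by rewrite addrACA.
Qed.

HB.instance Definition _ a b :=
  GRing.isSubmodClosed.Build K {poly K} (diff_space a b)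
    (diff_space_submod a b).

Definition diff_quot a b := quotmod (diff_space a b).

Definition diff_coset a b p : diff_quot a b := quotmod_pi (diff_space a b) p.

End DifferenceSpace.

(* Main.v *)
Require Import Defs.
From mathcomp Require Import all_boot all_order all_algebra.
From mathcomp Require Import boolp classical_sets.
From mathcomp Require Import ring.

Import GRing.Theory.
Local Open Scope classical_set_scope.
Local Open Scope ring_scope.

(** Put [t = k + gamma], [h = (alpha + 1) / 2] and [B(u) = b(beta + u)], so that
    [B] is even or odd.  The shift [gamma] is the one for which the two
    coefficients of the difference operator become mirror images of each other:
    [a(k) = - B(t + h)] and [b(k - 1) = B(t - h)].  Feeding the operator
    [x(k) = - (t - 1/2)^j], whose shift is [x(k + 1) = - (t + 1/2)^j], gives the
    element
      [p_j(t) = B(t + h) (t + 1/2)^j + B(t - h) (t - 1/2)^j]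
    of the difference space ([symmetric_image_in_diff_space]).  Replacing [t] by [- t] exchanges the two summands
    up to a common sign, so [p_j] is even or odd in [t]
    ([symmetric_image_parity]).  Both summands have degree [deg a + j] and the
    same leading coefficient, so these add up to [2 lc(b)], which is nonzero
    outside characteristic 2 ([symmetric_image_top_coef]).

    Thus, modulo the difference space, [t^(deg a + j)] is a combination of
    smaller powers of [t] with exponents of the same parity, and strong
    induction on the exponent brings every power below [deg a] without ever
    changing the parity ([pow_reduction]). *)

(** * Linear spans *)

Section LinSpan.
Context {R : nzRingType} {V : lmodType R}.
Implicit Types (G : set V) (u v : V).

Lemma lin_span_gen G v : G v -> lin_span G v.
Proof.
move=> Gv; exists 1%N, (fun=> 1), (fun=> v); split=> //.
by rewrite big_ord1 scale1r.
Qed.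

Lemma lin_span0 G : lin_span G 0.
Proof.
exists 0%N, (fun=> 0), (fun i : 'I_0 => 0); split=> [[]//|].
by rewrite big_ord0.
Qed.

Lemma lin_spanZ G c v : lin_span G v -> lin_span G (c *: v).
Proof.
move=> [n [e [g [Gg ->]]]]; exists n, (fun i => c * e i), g; split=> //.
by rewrite scaler_sumr; apply: eq_bigr => i _; rewrite scalerA.
Qed.

Lemma lin_spanD G u v : lin_span G u -> lin_span G v -> lin_span G (u + v).
Proof.
move=> [n1 [c1 [g1 [G1 ->]]]] [n2 [c2 [g2 [G2 ->]]]].
pose glue T (f1 : 'I_n1 -> T) (f2 : 'I_n2 -> T) (i : 'I_(n1 + n2)) :=
  match split i with inl i1 => f1 i1 | inr i2 => f2 i2 end.
exists (n1 + n2)%N, (glue R c1 c2), (glue V g1 g2); split=> [i|].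
  by rewrite /glue; case: (split i).
rewrite big_split_ord /glue; congr (_ + _); apply: eq_bigr => i _.
  by rewrite (unsplitK (inl i)).
by rewrite (unsplitK (inr i)).
Qed.

Lemma lin_span_sum G n (f : 'I_n -> V) :
  (forall i, lin_span G (f i)) -> lin_span G (\sum_(i < n) f i).
Proof.
by move=> Gf; elim/big_ind: _ => // *; [exact: lin_span0|exact: lin_spanD].
Qed.

Lemma lin_span_mono G G' v : G `<=` G' -> lin_span G v -> lin_span G' v.
Proof.
by move=> sGG' [n [c [g [Gg ->]]]]; exists n, c, g; split=> // i; apply: sGG'.
Qed.

End LinSpan.

(** * Reducing powers by even or odd relations *)

Section Parity.
Context {K : fieldType}.
Hypothesis charK : 2%N \notin [pchar K].
Implicit Types p B : {poly K}.

Lemma two_neq0 : 2%:R != 0 :> K.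
Proof. by apply: contra charK => two0; apply/andP. Qed.

Lemma comp_polyNX p : p \Po - 'X = \poly_(i < size p) ((-1) ^+ i * p`_i).
Proof.
rewrite comp_polyE poly_def; apply: eq_bigr => i _.
by rewrite -scaleN1r exprZn scalerA mulrC.
Qed.

(** Comparing coefficients of [X^i] gives [(-1)^i = (-1)^s]; since [-1] differs
    from [1] outside characteristic 2, the parities agree. *)
Lemma odd_coef_index p s i :
  p \Po - 'X = (-1) ^+ s *: p -> p`_i != 0 -> odd i = odd s.
Proof.
move=> sym_p pi_neq0; have lt_i : (i < size p)%N.
  by rewrite ltnNge; apply: contraNN pi_neq0 => /(nth_default 0) ->.
have /(mulIf pi_neq0) : (-1) ^+ i * p`_i = (-1) ^+ s * p`_i.
  by rewrite -[RHS]coefZ -sym_p comp_polyNX coef_poly lt_i.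
have N1_neq1 : (-1 == 1 :> K) = false.
  by rewrite eq_sym -subr_eq0 opprK -mulr2n (negbTE two_neq0).
rewrite -signr_odd -[in RHS]signr_odd; case: (odd i); case: (odd s) => //= /eqP.
  by rewrite expr1 expr0 N1_neq1.
by rewrite expr1 expr0 eq_sym N1_neq1.
Qed.

(** If every degree from [d] on carries an even or odd relation, then solving
    it for its top power only involves powers of the same parity, so the
    parity survives the induction.  The map [L] is meant to be the class of
    [p(k + gamma)] modulo the difference space. *)
Lemma pow_reduction {V : lmodType K} (L : {linear {poly K} -> V}) d m :
  (forall j, exists p s, [/\ L p = 0, (size p <= (d + j).+1)%N,
     p`_(d + j) != 0 & p \Po - 'X = (-1) ^+ s *: p]) ->
  lin_span [set L 'X^i | i in [set i | (i < d)%N /\ odd i = odd m]] (L 'X^m).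
Proof.
move=> relation; have [n] := ubnP m; elim: n m => // n IHn m lt_mn.
have [lt_md|le_dm] := ltnP m d; first by apply: lin_span_gen; exists m.
have [p [s [Lp0 size_p top_p sym_p]]] := relation (m - d)%N.
rewrite subnKC // in size_p top_p.
have -> : L 'X^m = \sum_(i < m) - (p`_m)^-1 *: (p`_i *: L 'X^i).
  have pE : p = \sum_(i < m.+1) p`_i *: 'X^i.
    rewrite -poly_def; apply/polyP => i; rewrite coef_poly.
    case: ltnP => // le_i; exact/nth_default/(leq_trans size_p).
  move: Lp0; rewrite {1}pE big_ord_recr linearD linear_sum linearZ /=.
  move/eqP; rewrite addrC addr_eq0 => /eqP top_eq.
  rewrite -scaler_sumr scaleNr -scalerN.
  under eq_bigr do rewrite -linearZ.
  by rewrite -top_eq scalerA mulVf // scale1r.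
apply: lin_span_sum => i; apply: lin_spanZ.
have [-> | pi_neq0] := eqVneq p`_i 0; first by rewrite scale0r; exact: lin_span0.
have <- : odd i = odd m.
  by rewrite (odd_coef_index _ _ _ sym_p pi_neq0) (odd_coef_index _ _ _ sym_p top_p).
by apply/lin_spanZ/IHn; exact: leq_trans (ltn_ord i) _.
Qed.

(** * Symmetric images *)

Definition symmetric_image B (h e : K) j : {poly K} :=
  (B \Po ('X + h%:P)) * ('X + e%:P) ^+ j
  + (B \Po ('X - h%:P)) * ('X - e%:P) ^+ j.

(** The substitution of [- 'X] exchanges the two summands, each up to the sign
    [(-1)^s] coming from [B] and the sign [(-1)^j] coming from the power. *)
Lemma symmetric_image_parity B h e j s :
  B \Po - 'X = (-1) ^+ s *: B ->
  symmetric_image B h e j \Po - 'X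
    = (-1) ^+ (s + j) *: symmetric_image B h e j.
Proof.
move=> sym_B.
have half c f : ((B \Po ('X + c%:P)) * ('X + f%:P) ^+ j) \Po - 'X
    = (-1) ^+ (s + j) *: ((B \Po ('X - c%:P)) * ('X - f%:P) ^+ j).
  have flip g : ('X + g%:P) \Po - 'X = - 'X \Po ('X - g%:P).
    by rewrite comp_polyD comp_polyX comp_polyC raddfN /= comp_polyX opprB addrC.
  rewrite comp_polyM -comp_polyA flip comp_polyA sym_B comp_polyZ.
  rewrite rmorphXn /= flip raddfN /= comp_polyX -[- (_ - _)]scaleN1r exprZn.
  by rewrite -scalerAl -scalerAr scalerA exprD.
rewrite /symmetric_image comp_polyD half scalerDr addrC; congr (_ + _).
by rewrite -!polyCN half !polyCN !opprK.
Qed.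

Lemma shift_mul_top B c e j : B != 0 ->
  let f := (B \Po ('X + c%:P)) * ('X + e%:P) ^+ j in
  size f = (size B + j)%N /\ lead_coef f = lead_coef B.
Proof.
move=> B_neq0 f.
have mon_e : ('X + e%:P) ^+ j \is monic by rewrite rpredX // monicXaddC.
rewrite /f lead_coef_Mmonic // lead_coef_comp ?size_XaddC //.
rewrite (monicP (monicXaddC c)) expr1n mulr1; split=> //.
rewrite size_Mmonic // ?comp_poly2_eq0 ?size_XaddC //.
by rewrite size_comp_poly2 ?size_XaddC // -(opprK e) polyCN size_exp_XsubC addnS.
Qed.

(** The two leading terms are equal, hence add up instead of cancelling. *)
Lemma symmetric_image_top_coef B h e j : B != 0 ->
  let p := symmetric_image B h e j in
  (size p <= ((size B).-1 + j).+1)%N /\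
  p`_((size B).-1 + j) = 2%:R * lead_coef B.
Proof.
move=> B_neq0 p.
have sizeB : (size B + j = ((size B).-1 + j).+1)%N.
  by rewrite -addSn prednK // size_poly_gt0.
have [size1 lead1] := shift_mul_top B h e j B_neq0.
have [] := shift_mul_top B (- h) (- e) j B_neq0; rewrite !polyCN => size2 lead2.
rewrite sizeB in size1 size2; split.
  by apply: leq_trans (size_polyD _ _) _; rewrite size1 size2 maxnn.
move: lead1 lead2; rewrite !lead_coefE size1 size2 /= => lead1 lead2.
by rewrite coefD lead1 lead2 mulr_natl mulr2n.
Qed.

End Parity.

(** The witness is [- (k + gamma - 1/2)^j]: the half-integral offset makes its
    shift by 1 the mirror image of itself around [k + gamma], and the sign
    cancels the one relating [a] to [b]. *)
Lemma symmetric_image_in_diff_space (K : fieldType) (b : {poly K})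
    (alpha beta : K) (gamma := - beta + (alpha - 1) / 2%:R) j :
  2%:R != 0 :> K ->
  symmetric_image (b \Po (beta%:P + 'X)) ((alpha + 1) / 2%:R) 2%:R^-1 j
    \Po ('X + gamma%:P) \in diff_space (- (b \Po ('X + alpha%:P))) b.
Proof.
move=> two_neq0; apply/asboolP.
exists (- ('X + (gamma - 2%:R^-1)%:P) ^+ j).
have shiftD c d : ('X + c%:P) \Po ('X + d%:P) = 'X + (d + c)%:P :> {poly K}.
  by rewrite comp_polyD comp_polyX comp_polyC -addrA -polyCD.
rewrite /symmetric_image /diff_op comp_polyD !comp_polyM !rmorphXn /=.
rewrite -!comp_polyA [beta%:P + 'X]addrC raddfN /= rmorphXn /=.
rewrite mulrNN mulrN opprK -polyC1 -!polyCN !shiftD.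
have -> : gamma + (alpha + 1) / 2%:R + beta = alpha by rewrite /gamma; field.
have -> : gamma - (alpha + 1) / 2%:R + beta = -1 by rewrite /gamma; field.
by have -> : 1 + (gamma - 2%:R^-1) = gamma + 2%:R^-1 by field.
Qed.

Theorem theorem2 (K : fieldType) (a b : {poly K}) (alpha beta : K)
    (charK : 2%N \notin [pchar K])
    (a_neq0 : a != 0) (b_neq0 : b != 0)
    (hab : a = - (b \Po ('X + alpha%:P)))
    (hb : b \Po (beta%:P + 'X) = b \Po (beta%:P - 'X) \/
          b \Po (beta%:P + 'X) = - (b \Po (beta%:P - 'X)))
    (m : nat) :
  let gamma : K := - beta + (alpha - 1) / 2%:R in
  let coset_pow (j : nat) : diff_quot a b :=
    diff_coset a b (('X + gamma%:P) ^+ j) in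
  lin_span [set coset_pow (2 * i)%N | i in
              [set i : nat | (2 * i < (size a).-1)%N]]
    (coset_pow (2 * m)%N)
  /\
  lin_span [set coset_pow (2 * i + 1)%N | i in
              [set i : nat | (2 * i + 1 < (size a).-1)%N]]
    (coset_pow (2 * m + 1)%N).
Proof.
move=> gamma coset_pow; have two_neq0 := two_neq0 charK.
pose B := b \Po (beta%:P + 'X).
have [s sym_B] : exists s, B \Po - 'X = (-1) ^+ s *: B.
  have BN : B \Po - 'X = b \Po (beta%:P - 'X).
    by rewrite -comp_polyA comp_polyD comp_polyC comp_polyX.
  case: hb => hb'; [exists 0%N | exists 1%N]; rewrite BN /B hb'.
    by rewrite scale1r.
  by rewrite expr1 scaleN1r opprK.
have B_neq0 : B != 0 by rewrite comp_poly2_eq0 // addrC size_XaddC.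
have size_B : size B = size a.
  by rewrite hab size_polyN !size_comp_poly2 // ?size_XaddC // addrC size_XaddC.
pose L : {linear {poly K} -> diff_quot a b} :=
  quotmod_pi (diff_space a b) \o comp_poly ('X + gamma%:P).
have LX j : L 'X^j = coset_pow j by rewrite /L /= comp_Xn_poly.
have reduce n : lin_span
    [set L 'X^i | i in [set i | (i < (size a).-1)%N /\ odd i = odd n]] (L 'X^n).
  apply: (pow_reduction charK) => j.
  exists (symmetric_image B ((alpha + 1) / 2%:R) 2%:R^-1 j), (s + j)%N.
  have [] := symmetric_image_top_coef B ((alpha + 1) / 2%:R) 2%:R^-1 j B_neq0.
  rewrite size_B => size_p top_p; split=> //.
  - rewrite /L /= -[RHS](linear0 (quotmod_pi (diff_space a b))).
    apply/quotmod_piP; rewrite subr0 hab; exact: symmetric_image_in_diff_space.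
  - by rewrite top_p mulf_neq0 // lead_coef_eq0.
  - exact: symmetric_image_parity.
split; rewrite -LX; apply: lin_span_mono (reduce _).
- move=> _ [i [lt_i odd_i] <-].
  have iE : (2 * i./2 = i)%N.
    by rewrite -[RHS]odd_double_half odd_i oddM mul2n.
  by exists i./2; rewrite ?LX /= iE.
- move=> _ [i [lt_i odd_i] <-].
  have iE : (2 * i./2 + 1 = i)%N.
    by rewrite -[RHS]odd_double_half odd_i oddD oddM mul2n addnC.
  by exists i./2; rewrite ?LX /= iE.
Qed.
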